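(* Let $(A,P)$ be a Rota-Baxter (associative) algebra of weight $\lambda\in\mathbf k$ over a field $\mathbf k$ of characteristic $p>0$. Let $A^-$ be the commutator Lie algebra of $A$ and $(-)^p$ the $p$-th power map of $A$. Then $(A^-,(-)^p,P)$ is a restricted Rota-Baxter Lie algebra of weight $\lambda$.
   Context: Convention: $\mathbf k$ is an algebraically closed field of prime characteristic $p$; everything is over $\mathbf k$. A Rota-Baxter algebra of weight $\lambda$ is an associative algebra $A$ with a linear map $P:A\to A$ such that $P(x)P(y)=P(P(x)y)+P(xP(y))+\lambda P(xy)$ for all $x,y\in A$. Restricted Lie algebra: a Lie algebra $(\mathfrak g,[-,-])$ with a $p$-map $(-)^{[p]}:\mathfrak g\to\mathfrak g$ satisfying $(ax)^{[p]}=a^px^{[p]}$ for $a\in\mathbf k$, $[x^{[p]},y]=(\mathrm{ad}_x)^p(y)$, and $(x+y)^{[p]}=x^{[p]}+y^{[p]}+\sum_{i=1}^{p-1}s_i(x,y)$, where $i\,s_i(x,y)$ is the coefficient of $t^{i-1}$ in $(\mathrm{ad}_{tx+y})^{p-1}(x)\in\mathbf k[t]\otimes\mathfrak g$. For a composition $\alpha=(\alpha_1,\dots,\alpha_r)\vDash n$ (a tuple of positive integers with sum $n$, of length $\ell(\alpha)=r$), $C_\alpha=\prod_{k=1}^r\binom{\alpha_1+\cdots+\alpha_k-1}{\alpha_k-1}$. A restricted Rota-Baxter Lie algebra $(\mathfrak g,[-,-],(-)^{[p]},R)$ of weight $\lambda$ is a restricted Lie algebra with a linear map $R$ such that $[R(x),R(y)]=R([R(x),y])+R([x,R(y)])+\lambda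 R([x,y])$ and $R(x^{[p]_R})=R(x)^{[p]}$ for all $x,y\in\mathfrak g$, where, with $x\rhd_Ry:=[R(x),y]$ and $x^{\rhd_Rk}:=x\rhd_R(x\rhd_R\cdots(x\rhd_Rx)\cdots)$ ($k$ copies of $x$, $x^{\rhd_R1}=x$), $$x^{[p]_R}:=\lambda^{p-1}x^{[p]}+\sum_{r=1}^{p-1}\frac1r\lambda^{r-1}\sum_{\alpha\vDash p,\ \ell(\alpha)=r}C_\alpha\,[x^{\rhd_R\alpha_1},[x^{\rhd_R\alpha_2},[\cdots[x^{\rhd_R\alpha_{r-1}},x^{\rhd_R\alpha_r}]\cdots]]]$$ ($\lambda^0=1$; $\frac1r$ is the inverse of $r$ modulo $p$). *)

(* Defs.v *)
From mathcomp Require Import all_boot all_algebra.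

Set Implicit Arguments.
Unset Strict Implicit.
Unset Printing Implicit Defensive.

Import GRing.Theory.
Local Open Scope ring_scope.

Definition is_bilinear (k : fieldType) (V : lmodType k) (b : V -> V -> V) : Prop :=
  (forall x, linear (b x)) /\ (forall y, linear (b^~ y)).

(* Algebras need not be unital, which algType would impose; see
   algType_is_assoc_algebra for the unital case. *)
Record is_assoc_algebra (k : fieldType) (A : lmodType k) (mul : A -> A -> A) :
    Prop := IsAssocAlgebra {
  assoc_bilinear : is_bilinear mul;
  assoc_mulA : associative mul }.

Record is_rota_baxter_algebra (k : fieldType) (lam : k) (A : lmodType k)
    (mul : A -> A -> A) (P : A -> A) : Prop := IsRotaBaxterAlgebra {
  rb_assoc : is_assoc_algebra mul;
  rb_linear : linear P;
  rb_identity : forall x y,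
    mul (P x) (P y) = P (mul (P x) y) + P (mul x (P y)) + lam *: P (mul x y) }.

Record is_lie_algebra (k : fieldType) (g : lmodType k) (br : g -> g -> g) :
    Prop := IsLieAlgebra {
  lie_bilinear : is_bilinear br;
  lie_alternating : forall x, br x x = 0;
  lie_jacobi : forall x y z,
    br x (br y z) + br y (br z x) + br z (br x y) = 0 }.

(* An element of k[t] (x) g is represented by its sequence of coefficients
   nat -> g, the value at i being the coefficient of t^i; the bracket is the
   k[t]-bilinear extension of the one of g. *)
Definition pbr (k : fieldType) (g : lmodType k) (br : g -> g -> g)
    (u v : nat -> g) : nat -> g :=
  fun n => \sum_(i < n.+1) br (u i) (v (n - i)%N).

Definition pconst (k : fieldType) (g : lmodType k) (x : g) : nat -> g :=
  fun n => if n is 0 then x else 0.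

(* t x + y *)
Definition paffine (k : fieldType) (g : lmodType k) (x y : g) : nat -> g :=
  fun n => match n with 0 => y | 1 => x | _ => 0 end.

(* Meaningful for 1 <= i < p, where i is invertible in k. *)
Definition jacobson_s (k : fieldType) (g : lmodType k) (p : nat)
    (br : g -> g -> g) (i : nat) (x y : g) : g :=
  (i%:R : k)^-1 *: iter p.-1 (pbr br (paffine x y)) (pconst x) i.-1.

Record is_restricted_lie_algebra (k : fieldType) (p : nat) (g : lmodType k)
    (br : g -> g -> g) (pmap : g -> g) : Prop := IsRestrictedLieAlgebra {
  restricted_lie : is_lie_algebra br;
  pmapZ : forall (a : k) x, pmap (a *: x) = a ^+ p *: pmap x;
  pmap_ad : forall x y, br (pmap x) y = iter p (br x) y;
  pmapD : forall x y,
    pmap (x + y) = pmap x + pmap y + \sum_(1 <= i < p) jacobson_s p br i x y }.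

Definition is_composition (n : nat) (a : seq nat) : bool :=
  all (fun m => 0 < m)%N a && (sumn a == n).

(* With positions numbered from 0, sumn (take k.+1 a) is
   alpha_1 + ... + alpha_(k+1) and nth 0 a k is alpha_(k+1). *)
Definition comp_coef (a : seq nat) : nat :=
  (\prod_(k < size a) 'C((sumn (take k.+1 a)).-1, (nth 0 a k).-1))%N.

Fixpoint nested_br (k : fieldType) (g : lmodType k) (br : g -> g -> g)
    (s : seq g) : g :=
  match s with
  | [::] => 0
  | [:: x] => x
  | x :: s' => br x (nested_br br s')
  end.

Definition rhd (k : fieldType) (g : lmodType k) (br : g -> g -> g) (R : g -> g)
    (x y : g) : g := br (R x) y.

(* Meaningful for n >= 1. *)
Definition rhd_pow (k : fieldType) (g : lmodType k) (br : g -> g -> g)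
    (R : g -> g) (x : g) (n : nat) : g :=
  iter n.-1 (rhd br R x) x.

(* The parts of a composition of p are at most p, so the compositions of p of
   length r are found among the r-tuples with entries in 'I_p.+1. *)
Definition pmap_R (k : fieldType) (p : nat) (lam : k) (g : lmodType k)
    (br : g -> g -> g) (pmap : g -> g) (R : g -> g) (x : g) : g :=
  lam ^+ p.-1 *: pmap x +
  \sum_(1 <= r < p) ((r%:R : k)^-1 * lam ^+ r.-1) *:
    \sum_(a : r.-tuple 'I_p.+1 | is_composition p (map val a))
      nested_br br [seq rhd_pow br R x m | m <- map val a]
        *+ comp_coef (map val a).

Record is_restricted_rota_baxter_lie_algebra (k : fieldType) (p : nat)
    (lam : k) (g : lmodType k) (br : g -> g -> g) (pmap : g -> g) (R : g -> g) :
    Prop := IsRestrictedRotaBaxterLieAlgebra {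
  rrb_restricted : is_restricted_lie_algebra p br pmap;
  rrb_linear : linear R;
  rrb_identity : forall x y,
    br (R x) (R y) = R (br (R x) y) + R (br x (R y)) + lam *: R (br x y);
  rrb_pmap : forall x, R (pmap_R p lam br pmap R x) = pmap (R x) }.

Definition commutator (k : fieldType) (A : lmodType k) (mul : A -> A -> A)
    (x y : A) : A := mul x y - mul y x.

(* Meaningful for n >= 1, as A may have no unit. *)
Definition power (k : fieldType) (A : lmodType k) (mul : A -> A -> A)
    (n : nat) (x : A) : A := iter n.-1 (mul x) x.

Lemma algType_is_assoc_algebra (k : fieldType) (A : algType k) :
  @is_assoc_algebra k A *%R.
Proof.
split; last exact: mulrA.
split=> [x|y] a u v; first by rewrite mulrDr scalerAr.
by rewrite mulrDl scalerAl.
Qed.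

Lemma algType_power (k : fieldType) (A : algType k) (n : nat) (x : A) :
  @power k A *%R n.+1 x = x ^+ n.+1.
Proof. by elim: n => [|n IHn] //; rewrite exprS -IHn. Qed.

(* Main.v *)
(** For [a = P x], the associative product
    [x * y = P(x) y + x P(y) + lam x y] is carried by [P] to the product of
    [A], so [P(x)^p] is the image of the [p]-th [*]-power of [x].  That power is
    formally [((a + lam x)^p - a^p) / lam], i.e. [sum_r lam^(r-1) W_r] where
    [W_r] is the coefficient of [t^r] in [(x t + a)^p].  Jacobson's argument
    (differentiate in [t]) identifies [r W_r], for [0 < r < p], with the
    coefficient of [t^(r-1)] in [ad_(x t + a)^(p-1) x].  Finally, in any Lie
    algebra, Pascal's rule expands [ad_(x t + a)^(n-1) x] as the sum over
    compositions [alpha] of [n] of [C_alpha] times a nested bracket of the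
    [ad_a^(alpha_i - 1) x], by splitting off the last part of [alpha].
    Computations take place in polynomials over the unitization of [A]. *)
Require Import Defs.
From HB Require Import structures.
From mathcomp Require Import all_boot all_algebra.

Set Implicit Arguments.
Unset Strict Implicit.
Unset Printing Implicit Defensive.
Import GRing.Theory.
Local Open Scope ring_scope.

(** Induction step of the binomial expansions below: an operator sending [f i j] to
    [f i.+1 j + f i j.+1] carries row [n] to row [n.+1]. *)
Lemma pascal_sum (V : nmodType) (f : nat -> nat -> V) n :
  \sum_(i < n.+1) (f (n - i).+1 i + f (n - i)%N i.+1) *+ 'C(n, i) =
  \sum_(i < n.+2) f (n.+1 - i)%N i *+ 'C(n.+1, i).
Proof.
rewrite [RHS]big_ord_recl /= bin0.
under [X in _ = _ + X]eq_bigr do rewrite /bump leq0n add1n subSS binS mulrnDr.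
under eq_bigr do rewrite mulrnDl.
rewrite !big_split /= addrA; congr (_ + _).
rewrite big_ord_recl /= !subn0 bin0; congr (_ + _).
rewrite big_ord_recr /= bin_small // mulr0n addr0.
by apply: eq_bigr => i _; rewrite /bump leq0n add1n subnSK.
Qed.

Section LinearProp.
Variables (k : fieldType) (U V : lmodType k) (f : U -> V).
Hypothesis lin_f : linear f.

Let fL : {linear U -> V} := HB.pack f (GRing.isLinear.Build k U V *:%R f lin_f).

Lemma linear_propD : {morph f : x y / x + y}. Proof. exact: (raddfD fL). Qed.
Lemma linear_propB : {morph f : x y / x - y}. Proof. exact: (raddfB fL). Qed.
Lemma linear_propZ c : {morph f : x / c *: x}.
Proof. exact: (linearZ_LR fL). Qed.
Lemma linear_prop0 : f 0 = 0. Proof. exact: (raddf0 fL). Qed.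
Lemma linear_propMn n : {morph f : x / x *+ n}. Proof. exact: (raddfMn fL). Qed.
Lemma linear_prop_sum I r (P : pred I) E :
  f (\sum_(i <- r | P i) E i) = \sum_(i <- r | P i) f (E i).
Proof. exact: (raddf_sum fL). Qed.
End LinearProp.

(** * Compositions and their last part *)

Section Compositions.
Local Open Scope nat_scope.

Lemma is_composition_rcons n s m :
  is_composition n (rcons s m) = [&& 0 < m, m <= n & is_composition (n - m) s].
Proof.
rewrite /is_composition all_rcons sumn_rcons -andbA; case: (0 < m) => //=.
case: leqP => [le_mn|lt_nm] /=.
  by rewrite -[X in _ == X](subnK le_mn) eqn_add2r.
by rewrite andbC; case: eqP => // E; rewrite -E ltnNge leq_addl in lt_nm.
Qed.

(** Each factor depends only on a prefix, so appending a part leaves the earlier factors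
    unchanged. *)
Lemma comp_coef_rcons s m :
  comp_coef (rcons s m) = comp_coef s * 'C((sumn s + m).-1, m.-1).
Proof.
rewrite /comp_coef size_rcons big_ord_recr /= nth_rcons ltnn eqxx.
rewrite take_oversize ?size_rcons // sumn_rcons; congr (_ * _).
apply: eq_bigr => i _; rewrite nth_rcons ltn_ord -cats1 takel_cat //.
Qed.
End Compositions.

(** [M] stays fixed while [n] decreases in inductions; [n < M] ensures that the largest possible
    part [n.+1] fits in ['I_M.+1]. *)
Lemma sum_composition_rcons (V : nmodType) (h : seq nat -> V) M n r :
  (n < M)%N ->
  \sum_(s : r.+1.-tuple 'I_M.+1 | is_composition n.+1 (map val s))
    h (map val s) =
  \sum_(j < n.+1)
    \sum_(s : r.-tuple 'I_M.+1 | is_composition (n - j) (map val s))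
      h (rcons (map val s) j.+1).
Proof.
move=> ltnM.
pose last_split (s : r.+1.-tuple 'I_M.+1) :=
  (last ord0 s, [tuple of belast (thead s) (behead s)]).
pose glue (q : 'I_M.+1 * r.-tuple 'I_M.+1) := [tuple of rcons q.2 q.1].
have glueK : cancel glue last_split.
  case=> m s; congr (_, _); first by rewrite /= last_rcons.
  apply: val_inj => /=; rewrite /thead (tnth_nth ord0) /=.
  case: (val s) => [|y t] //=; by rewrite belast_rcons.
have splitK : cancel last_split glue.
  move=> s; apply: val_inj; case/tupleP: s => y t /=.
  by rewrite theadE -lastI.
rewrite (reindex glue) /=; last by apply: onW_bij; exists last_split.
rewrite big_mkcond -(pair_bigA _ (fun (m : 'I_M.+1) (s : r.-tuple 'I_M.+1) =>
  if is_composition n.+1 (map val (rcons s m)) then h (map val (rcons s m)) else 0)) /=.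
rewrite big_ord_recl big1 ?add0r; last first.
  by move=> s _; rewrite map_rcons is_composition_rcons.
(* For [j > n] the last part exceeds the total, so the added indices match empty sums. *)
rewrite (big_ord_widen _ (fun j => \sum_(s : r.-tuple 'I_M.+1 |
  is_composition (n - j) (map val s)) h (rcons (map val s) j.+1)) ltnM).
rewrite [RHS]big_mkcond; apply: eq_bigr => j _.
under eq_bigr do
  rewrite map_rcons is_composition_rcons /= /bump leq0n add1n ltnS subSS.
rewrite ltnS -big_mkcond; case: ifP => _ //=.
by rewrite big_pred0.
Qed.

(** * Iterated brackets and compositions *)

Section LieCompositions.
Variables (k : fieldType) (g : lmodType k) (br : g -> g -> g).
Hypothesis lie_br : is_lie_algebra br.
Variables (x a : g).

Let brr_lin u : linear (br u). Proof. exact: (lie_bilinear lie_br).1. Qed.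
Let brl_lin u : linear (br^~ u). Proof. exact: (lie_bilinear lie_br).2. Qed.

Lemma lie_antisym y z : br y z = - br z y.
Proof.
apply/eqP; rewrite -addr_eq0; apply/eqP.
have := lie_alternating lie_br (y + z).
rewrite (linear_propD (brr_lin _)) !(linear_propD (brl_lin _)).
by rewrite !(lie_alternating lie_br) add0r addr0 addrC.
Qed.

Lemma lie_derivation u y z : br u (br y z) = br (br u y) z + br y (br u z).
Proof.
have := lie_jacobi lie_br u y z.
rewrite (lie_antisym z (br u y)) (lie_antisym z u).
rewrite -scaleN1r (linear_propZ (brr_lin _)) scaleN1r.
by move/eqP; rewrite -addrA -opprD subr_eq0 addrC => /eqP.
Qed.

Variable M : nat.

(* [comp_ad n r] is the operator coefficient of [t^r] in the [n]-th iterate, on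
   the identity, of [F |-> (ad_a + t ad_x) o F - F o ad_a]: this is
   [comp_ad_commute]. *)
Definition comp_ad n r z : g :=
  \sum_(s : r.-tuple 'I_M.+1 | is_composition n (map val s))
    foldr br z [seq iter m.-1 (br a) x | m <- map val s]
      *+ comp_coef (map val s).

Lemma comp_ad0 r z : comp_ad 0 r z = if r is 0 then z else 0.
Proof.
case: r => [|r]; rewrite /comp_ad.
  rewrite (bigD1 [tuple]) //= big1 ?addr0 => [|s]; last first.
    by case/andP=> _ /eqP[]; apply: tuple0.
  by rewrite /comp_coef big_ord0.
apply: big_pred0 => s.
case/tupleP: s => m t.
rewrite /is_composition /= addn_eq0.
by case: (val m) => [|?]; rewrite /= ?andbF.
Qed.

Lemma comp_adD n r : {morph comp_ad n r : y z / y + z}.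
Proof.
move=> y z; rewrite /comp_ad -big_split; apply: eq_bigr => s _ /=.
rewrite -mulrnDl; congr (_ *+ _).
by elim: (map _ _) => //= u t ->; rewrite (linear_propD (brr_lin _)).
Qed.

Lemma comp_adS0 n z : comp_ad n.+1 0 z = 0.
Proof. by rewrite /comp_ad big_pred0 // => s; rewrite tuple0. Qed.

(** The last part [j.+1] acts innermost, hence directly on [z]; its factor in C_alpha is
    ['C(n, j)]. *)
Lemma comp_adSS n r z : (n < M)%N ->
  comp_ad n.+1 r.+1 z =
  \sum_(j < n.+1) comp_ad (n - j) r (br (iter j (br a) x) z) *+ 'C(n, j).
Proof.
move=> ltnM; rewrite /comp_ad.
rewrite (sum_composition_rcons (fun s => foldr br z
  [seq iter m.-1 (br a) x | m <- s] *+ comp_coef s)) //.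
apply: eq_bigr => j _; rewrite -sumrMnl; apply: eq_bigr => s /andP[_ /eqP ds].
rewrite map_rcons foldr_rcons comp_coef_rcons ds addnS /= subnK ?mulrnA //.
by rewrite -ltnS.
Qed.

(** Strong induction on [n]: once the last part is split off, the hypothesis at [n - j] leaves
    [br a] in front of [br (iter j (br a) x) z]; as a derivation it gives one term with [j.+1] and
    one with [br a z], and Pascal's rule collects the former. *)
Lemma comp_ad_commute n r z : (n < M)%N ->
  br a (comp_ad n r z) + (if r is r'.+1 then br x (comp_ad n r' z) else 0) =
  comp_ad n.+1 r z + comp_ad n r (br a z).
Proof.
elim/ltn_ind: n r z => -[_|n IHn] r z ltnM.
  case: r => [|r]; rewrite ?comp_adS0 ?comp_adSS // ?comp_ad0 ?addr0 ?add0r //.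
  rewrite (linear_prop0 (brr_lin _)) add0r big_ord1 comp_ad0 bin0.
  by case: r => //; rewrite (linear_prop0 (brr_lin _)).
case: r => [|r]; first by rewrite !comp_adS0 (linear_prop0 (brr_lin _)) addr0.
rewrite (comp_adSS _ _ ltnM).
rewrite -(pascal_sum (fun i j => comp_ad i r (br (iter j (br a) x) z))).
rewrite !(comp_adSS _ _ (ltnW ltnM)).
rewrite (linear_prop_sum (brr_lin _)).
have -> : br x (comp_ad n.+1 r z) = \sum_(j < n.+1)
    (if r is r'.+1 then br x (comp_ad (n - j) r' (br (iter j (br a) x) z))
     else 0)
      *+ 'C(n, j).
  case: r => [|r].
    rewrite comp_adS0 (linear_prop0 (brr_lin _)) big1 // => j.
    by rewrite mul0rn.
  rewrite (comp_adSS _ _ (ltnW ltnM)) (linear_prop_sum (brr_lin _)).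
  by apply: eq_bigr => j _; rewrite (linear_propMn (brr_lin _)).
rewrite -!big_split; apply: eq_bigr => j _ /=.
rewrite (linear_propMn (brr_lin _)) -!mulrnDl; congr (_ *+ _).
rewrite IHn ?ltnS ?leq_subr //; last first.
  by rewrite (leq_ltn_trans (leq_subr _ _)) // ltnW.
by rewrite lie_derivation comp_adD -addrA.
Qed.

Lemma pbr_paffine (v : nat -> g) r :
  pbr br (paffine x a) v r =
  br a (v r) + (if r is r'.+1 then br x (v r') else 0).
Proof.
rewrite /pbr; case: r => [|r]; first by rewrite big_ord1 addr0.
rewrite 2!big_ord_recl big1 ?addr0 ?subn0 /= ?subSS ?subn0 // => i _.
exact: (linear_prop0 (brl_lin _)).
Qed.

(** With T = ad_a + t ad_x, the map F |-> T F is the sum of the commuting maps F |-> T F - F ad_a,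
    which raises [n] in [comp_ad], and F |-> F ad_a; the binomial formula then expands T^n, here
    evaluated at [x]. *)
Lemma iter_pbr_comp_ad n r : (n <= M)%N ->
  iter n (pbr br (paffine x a)) (pconst x) r =
  \sum_(j < n.+1) comp_ad (n - j) r (iter j (br a) x) *+ 'C(n, j).
Proof.
elim: n r => [|n IHn] r le_nM; first by rewrite big_ord1 comp_ad0; case: r.
rewrite iterS pbr_paffine IHn ?(ltnW le_nM) //.
rewrite -(pascal_sum (fun i j => comp_ad i r (iter j (br a) x))).
have -> : (if r is r'.+1 then
    br x (iter n (pbr br (paffine x a)) (pconst x) r') else 0) =
  \sum_(j < n.+1) (if r is r'.+1 then
    br x (comp_ad (n - j) r' (iter j (br a) x)) else 0) *+ 'C(n, j).
  case: r => [|r]; first by rewrite big1 // => j; rewrite mul0rn.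
  rewrite (IHn _ (ltnW le_nM)) (linear_prop_sum (brr_lin _)).
  by apply: eq_bigr => j _; rewrite (linear_propMn (brr_lin _)).
rewrite (linear_prop_sum (brr_lin _)) -big_split; apply: eq_bigr => j _ /=.
rewrite (linear_propMn (brr_lin _)) -mulrnDl comp_ad_commute //.
by rewrite (leq_ltn_trans (leq_subr _ _)).
Qed.

Lemma nested_br_rcons s z : nested_br br (rcons s z) = foldr br z s.
Proof. by elim: s => //= y s <-; case: s. Qed.

(** In [iter_pbr_comp_ad], [iter j (br a) x] becomes the innermost entry of the nested bracket, for
    a last part [j.+1], and ['C(n, j)] the missing factor of C_alpha. *)
Lemma iter_pbr_composition n r : (n < M)%N ->
  iter n (pbr br (paffine x a)) (pconst x) r =
  \sum_(s : r.+1.-tuple 'I_M.+1 | is_composition n.+1 (map val s))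
    nested_br br [seq iter m.-1 (br a) x | m <- map val s]
      *+ comp_coef (map val s).
Proof.
move=> ltnM; rewrite iter_pbr_comp_ad ?(ltnW ltnM) //.
rewrite (sum_composition_rcons (fun s => nested_br br
  [seq iter m.-1 (br a) x | m <- s] *+ comp_coef s)) //.
apply: eq_bigr => j _; rewrite -sumrMnl; apply: eq_bigr => s /andP[_ /eqP ds].
rewrite map_rcons nested_br_rcons comp_coef_rcons ds addnS /= subnK ?mulrnA //.
by rewrite -ltnS.
Qed.

End LieCompositions.

Lemma pmap_R_jacobson (k : fieldType) (p : nat) (lam : k) (g : lmodType k)
    (br : g -> g -> g) (pmap R : g -> g) (x : g) :
  is_lie_algebra br -> (0 < p)%N ->
  pmap_R p lam br pmap R x = lam ^+ p.-1 *: pmap x +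
    \sum_(1 <= r < p) lam ^+ r.-1 *: jacobson_s p br r x (R x).
Proof.
move=> lie_br p_gt0; congr (_ + _).
apply: eq_big_nat => -[//|r] _; rewrite mulrC -scalerA; congr (_ *: (_ *: _)).
by rewrite (iter_pbr_composition lie_br _ _ _ (M := p)) ?prednK.
Qed.

(** * Jacobson's formula *)

Section Ad.
Variable B : nzRingType.
Implicit Types x y : B.

Definition ad x y := x * y - y * x.

(** [ad x] is the sum of two commuting operators: left multiplication by [x] and right
    multiplication by [- x]. *)
Lemma iter_ad n x y :
  iter n (ad x) y =
  \sum_(i < n.+1) (x ^+ (n - i) * y * (- x) ^+ i) *+ 'C(n, i).
Proof.
elim: n => [|n IHn]; first by rewrite big_ord1 mul1r mulr1.
rewrite iterS IHn -(pascal_sum (fun i j => x ^+ i * y * (- x) ^+ j)) /ad.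
rewrite mulr_sumr mulr_suml -sumrB; apply: eq_bigr => i _.
by rewrite mulrnAr mulrnAl -mulrnBl exprS exprSr !mulrA mulrN.
Qed.

(** Grouped so that the Jacobi sum telescopes. *)
Lemma ad_ad x y z :
  ad x (ad y z) = (x * y * z + z * y * x) - (x * z * y + y * z * x).
Proof.
by rewrite /ad mulrBr mulrBl !mulrA opprB opprD addrACA.
Qed.

Lemma ad_jacobi x y z : ad x (ad y z) + ad y (ad z x) + ad z (ad x y) = 0.
Proof.
rewrite !ad_ad (addrC (y * z * x)) (addrC (z * x * y)) (addrC (z * y * x)).
by rewrite !subrKA subrr.
Qed.

Variable p : nat.
Hypothesis pcharB : p \in [pchar B].

Let p_pr : prime p := pcharf_prime pcharB.

Lemma mulrn_bin_pchar i x : (0 < i < p)%N -> x *+ 'C(p, i) = 0.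
Proof.
move=> /(prime_dvd_bin p_pr)/dvdnP[q ->].
by rewrite mulrnA (mulrn_pchar pcharB).
Qed.

(** Only the two extreme terms survive modulo [p], and (-x)^p = -x^p even for p = 2. *)
Lemma iter_ad_pchar x y : iter p (ad x) y = ad (x ^+ p) y.
Proof.
rewrite iter_ad -(prednK (prime_gt0 p_pr)) big_ord_recl big_ord_recr /=.
rewrite prednK ?prime_gt0 // big1 ?add0r => [|i _]; last first.
  rewrite mulrn_bin_pchar //= /bump leq0n add1n /=.
  by rewrite -[X in (_ < X)%N](prednK (prime_gt0 p_pr)) ltnS.
rewrite /bump leq0n add1n prednK ?prime_gt0 // subnn subn0.
rewrite mul1r mulr1 bin0 binn.
by rewrite exprNn_pchar ?mulrN // (eq_pnat _ (pcharf_eq pcharB)) pnat_id.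
Qed.

(** ['C(p.-1, i) + 'C(p.-1, i.+1)] is ['C(p, i.+1)], zero in characteristic [p] when [i.+1 < p], so
    only the sign alternates. *)
Lemma mulrn_bin_pred_pchar i x : (i < p)%N -> x *+ 'C(p.-1, i) = (-1) ^+ i * x.
Proof.
elim: i => [|i IHi] lt_ip; first by rewrite bin0 mul1r.
apply/eqP; rewrite exprS mulN1r mulNr -addr_eq0 -IHi ?(ltnW lt_ip) //.
by rewrite -mulrnDr -binS prednK ?prime_gt0 // mulrn_bin_pchar.
Qed.

(** The sign of ['C(p.-1, i)] cancels that of (-x)^i; the result has the shape of [deriv_exp]. *)
Lemma iter_ad_pred_pchar x y :
  iter p.-1 (ad x) y = \sum_(i < p) x ^+ (p.-1 - i) * y * x ^+ i.
Proof.
rewrite iter_ad prednK ?prime_gt0 //; apply: eq_bigr => i _.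
rewrite mulrn_bin_pred_pchar // (exprNn x) (mulrA (_ * y)).
by rewrite (commr_sign (_ * y)) -(mulrA ((-1) ^+ i)) signrMK.
Qed.

(** Leibniz rule with the factors kept in order, since [q] need not commute with its derivative. *)
Lemma deriv_exp (q : {poly B}) n :
  (q ^+ n)^`() = \sum_(i < n) q ^+ (n.-1 - i) * q^`() * q ^+ i.
Proof.
elim: n => [|n IHn]; first by rewrite big_ord0 expr0 derivC.
rewrite exprSr derivM IHn mulr_suml big_ord_recl subn0 mulr1 addrC.
congr (_ + _); apply: eq_bigr => i _; rewrite /= /bump leq0n add1n -mulrA -exprSr.
by case: n i {IHn} => [[]|n i] //; rewrite subSS.
Qed.

End Ad.

(** * Coefficients of powers of x t + y *)

Section AffinePower.
Variables (B : nzRingType) (x y : B).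

Definition affine_poly : {poly B} := x%:P * 'X + y%:P.

Lemma coef_affine_poly i :
  affine_poly`_i = match i with 0 => y | 1 => x | _ => 0 end.
Proof.
by rewrite coefD coefMX !coefC; case: i => [|[]]; rewrite /= ?add0r ?addr0.
Qed.

Lemma coef_affine_polyM q i :
  (affine_poly * q)`_i = y * q`_i + (if i is j.+1 then x * q`_j else 0).
Proof.
rewrite mulrDl coefD coefCM addrC; congr (_ + _).
by rewrite -mulrA coefCM -commr_polyX coefMX; case: i => [|i]; rewrite ?mulr0.
Qed.

Lemma coef0_affine_polyX n : (affine_poly ^+ n)`_0 = y ^+ n.
Proof.
elim: n => [|n IHn]; first by rewrite coef1.
by rewrite exprS coef_affine_polyM IHn addr0 exprS.
Qed.

Lemma coef_affine_polyX_gt n i : (n < i)%N -> (affine_poly ^+ n)`_i = 0.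
Proof.
elim: n i => [|n IHn] [|i] //; first by rewrite coef1.
rewrite ltnS => lt_ni; rewrite exprS coef_affine_polyM !IHn ?mulr0 ?addr0 //.
exact: ltnW.
Qed.

Lemma coefn_affine_polyX n : (affine_poly ^+ n)`_n = x ^+ n.
Proof.
elim: n => [|n IHn]; first by rewrite coef1.
rewrite exprS coef_affine_polyM IHn coef_affine_polyX_gt //.
by rewrite mulr0 add0r exprS.
Qed.

Lemma exprD_affine_polyX n :
  (x + y) ^+ n = \sum_(i < n.+1) (affine_poly ^+ n)`_i.
Proof.
have -> : x + y = affine_poly.[1] by rewrite hornerD hornerMX !hornerC mulr1.
rewrite -horner_exp_comm; last by rewrite /comm_poly mulr1 mul1r.
rewrite (horner_coef_wide _ (n := n.+1)); last first.
  by apply/leq_sizeP => j; apply: coef_affine_polyX_gt.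
by apply: eq_bigr => i _; rewrite expr1n mulr1.
Qed.

(* Differentiating [(x t + y)^p] with respect to [t] gives
   [ad_(x t + y)^(p-1) x]. *)
Lemma coef_affine_polyX_pchar p i : p \in [pchar B] ->
  (affine_poly ^+ p)`_i.+1 *+ i.+1 = (iter p.-1 (ad affine_poly) x%:P)`_i.
Proof.
move=> pcharB; have pcharBX : p \in [pchar {poly B}] by rewrite pchar_poly.
rewrite -coef_deriv deriv_exp (iter_ad_pred_pchar pcharBX).
by rewrite derivD derivM derivX !derivC mul0r mulr1 add0r addr0.
Qed.

End AffinePower.

(* The scalar component adjoins a unit; [hA] is kept as a parameter so that
   the ring axioms are available to the canonical structures. *)
Definition unitization (k : fieldType) (A : lmodType k) (mul : A -> A -> A)
  (hA : is_assoc_algebra mul) : Type := (k^o * A)%type.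

(** * Unitization and the restricted Lie algebra of commutators *)

Section Unitization.
Variables (k : fieldType) (A : lmodType k) (mul : A -> A -> A).
Hypothesis hA : is_assoc_algebra mul.
Notation uA := (unitization hA).

HB.instance Definition _ := GRing.Lmodule.copy uA (k^o * A)%type.

Definition unitization_mul (u v : uA) : uA :=
  (u.1 * v.1, u.1 *: v.2 + v.1 *: u.2 + mul u.2 v.2).
Definition unitization_one : uA := (1, 0).

Let mulr_lin x : linear (mul x). Proof. exact: (assoc_bilinear hA).1. Qed.
Let mull_lin x : linear (mul^~ x). Proof. exact: (assoc_bilinear hA).2. Qed.

Fact unitization_mulA : associative unitization_mul.
Proof.
move=> [a x] [b y] [c z]; rewrite /unitization_mul /= mulrA; congr (_, _).
rewrite !(linear_propD (mulr_lin _)) !(linear_propD (mull_lin _)).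
rewrite !(linear_propZ (mulr_lin _)) !(linear_propZ (mull_lin _)).
rewrite (assoc_mulA hA) !scalerDr !scalerA -!addrA (mulrC c a) (mulrC c b).
congr (_ + (_ + _)); rewrite addrCA; congr (_ + _).
by rewrite !addrA; congr (_ + _); rewrite addrC addrA.
Qed.

Fact unitization_mul1r : left_id unitization_one unitization_mul.
Proof.
move=> [a x]; rewrite /unitization_mul /= mul1r scale1r scaler0.
by rewrite (linear_prop0 (mull_lin _)) !addr0.
Qed.

Fact unitization_mulr1 : right_id unitization_one unitization_mul.
Proof.
move=> [a x]; rewrite /unitization_mul /= mulr1 scale1r scaler0.
by rewrite (linear_prop0 (mulr_lin _)) add0r addr0.
Qed.

Fact unitization_mulDl : left_distributive unitization_mul +%R.
Proof.
move=> [a x] [b y] [c z]; rewrite /unitization_mul /=; congr (_, _) => /=.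
  by rewrite mulrDl.
rewrite scalerDl scalerDr (linear_propD (mull_lin _)).
by rewrite (addrACA (a *: z)) [LHS]addrACA.
Qed.

Fact unitization_mulDr : right_distributive unitization_mul +%R.
Proof.
move=> [a x] [b y] [c z]; rewrite /unitization_mul /=; congr (_, _) => /=.
  by rewrite mulrDr.
rewrite scalerDl scalerDr (linear_propD (mulr_lin _)).
by rewrite (addrACA (a *: y)) [LHS]addrACA.
Qed.

Fact unitization_oner_neq0 : unitization_one != 0.
Proof. by apply/eqP => -[/eqP]; rewrite oner_eq0. Qed.

HB.instance Definition _ := GRing.Zmodule_isNzRing.Build uA
  unitization_mulA unitization_mul1r unitization_mulr1 unitization_mulDl
  unitization_mulDr unitization_oner_neq0.

Fact unitization_scaleAl (c : k) (u v : uA) : c *: (u * v) = (c *: u) * v.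
Proof.
case: u v => [a x] [b y]; congr (_, _); rewrite /= ?scalerAl //.
rewrite (linear_propZ (mull_lin _)) !scalerDr !scalerA.
by rewrite [b * c]mulrC.
Qed.

Fact unitization_scaleAr (c : k) (u v : uA) : c *: (u * v) = u * (c *: v).
Proof.
case: u v => [a x] [b y]; congr (_, _); rewrite /= ?scalerAr //.
rewrite (linear_propZ (mulr_lin _)) !scalerDr !scalerA.
by rewrite [a * c]mulrC.
Qed.

HB.instance Definition _ :=
  GRing.Lmodule_isLalgebra.Build k uA unitization_scaleAl.
HB.instance Definition _ :=
  GRing.Lalgebra_isAlgebra.Build k uA unitization_scaleAr.

Definition unitize (x : A) : uA := (0, x).

Lemma unitize_inj : injective unitize. Proof. by move=> x y []. Qed.

Fact unitize_linear : linear unitize.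
Proof. by move=> c x y; congr (_, _); rewrite /= [_ *: _]mulr0 addr0. Qed.

HB.instance Definition _ :=
  GRing.isLinear.Build k A uA *:%R unitize unitize_linear.

Lemma unitizeM x y : unitize (mul x y) = unitize x * unitize y.
Proof. by congr (_, _); rewrite /= ?mulr0 // !scale0r !add0r. Qed.

Lemma unitize_power n x : unitize (power mul n.+1 x) = unitize x ^+ n.+1.
Proof. by elim: n => // n IHn; rewrite exprS -IHn -unitizeM. Qed.

Lemma unitize_commutator x y :
  unitize (commutator mul x y) = ad (unitize x) (unitize y).
Proof. by rewrite raddfB /= !unitizeM. Qed.

Lemma unitize_iter_commutator n x y :
  unitize (iter n (commutator mul x) y) = iter n (ad (unitize x)) (unitize y).
Proof. by elim: n => //= n <-; rewrite unitize_commutator. Qed.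

(** Turns the coefficient sequences of [pbr] into polynomials over [uA], where differentiation is
    available. *)
Lemma unitize_iter_pbr n x y i :
  unitize (iter n (pbr (commutator mul) (paffine x y)) (pconst x) i) =
  (iter n (ad (affine_poly (unitize x) (unitize y))) (unitize x)%:P)`_i.
Proof.
set T := affine_poly _ _.
have TE j : T`_j = unitize (paffine x y j).
  by rewrite coef_affine_poly; case: j => [|[]] //=; rewrite raddf0.
elim: n i => [|n IHn] i; first by rewrite coefC; case: i => //=; rewrite raddf0.
(* [coefMr] reverses the second convolution, so that both sums index [T] by the same [j]. *)
rewrite !iterS [ad T _]/ad coefB coefM coefMr -sumrB raddf_sum.
by apply: eq_bigr => j _ /=; rewrite TE -IHn unitize_commutator.
Qed.

Lemma commutator_lie : is_lie_algebra (commutator mul).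
Proof.
split=> [|x|x y z]; last 2 first.
- exact: subrr.
- apply: (@unitize_inj); rewrite 2!raddfD raddf0 /= !unitize_commutator.
  exact: ad_jacobi.
split=> [x|y] c u v; rewrite /commutator.
  rewrite (linear_propD (mulr_lin _)) (linear_propD (mull_lin _)).
  rewrite (linear_propZ (mulr_lin _)) (linear_propZ (mull_lin _)).
  by rewrite scalerBr opprD addrACA.
rewrite (linear_propD (mulr_lin _)) (linear_propD (mull_lin _)).
rewrite (linear_propZ (mulr_lin _)) (linear_propZ (mull_lin _)).
by rewrite scalerBr opprD addrACA.
Qed.

Variable p : nat.
Hypothesis pchark : p \in [pchar k].

Let p_gt0 : (0 < p)%N := prime_gt0 (pcharf_prime pchark).

Lemma pchar_unitization : p \in [pchar uA].
Proof. by rewrite pchar_lalg. Qed.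

(** [coef_affine_polyX_pchar] gives the equality multiplied by [i], which is invertible in [k] for 0
    < i < p. *)
Lemma unitize_jacobson_s i x y : (0 < i < p)%N ->
  unitize (jacobson_s p (commutator mul) i x y) =
  (affine_poly (unitize x) (unitize y) ^+ p)`_i.
Proof.
case: i => // i lt_ip; rewrite /jacobson_s linearZ /= unitize_iter_pbr.
rewrite -(coef_affine_polyX_pchar _ _ _ pchar_unitization).
rewrite -scaler_nat scalerA mulVf ?scale1r //.
by rewrite -(dvdn_pcharf pchark) gtnNdvd.
Qed.

Lemma commutator_restricted :
  is_restricted_lie_algebra p (commutator mul) (power mul p).
Proof.
have powE x : unitize (power mul p x) = unitize x ^+ p.
  by rewrite -(prednK p_gt0) unitize_power.
split=> [|c x|x y|x y]; first exact: commutator_lie.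
- by apply: (@unitize_inj); rewrite powE !linearZ /= powE exprZn.
- apply: (@unitize_inj); rewrite unitize_commutator powE.
  by rewrite unitize_iter_commutator (iter_ad_pchar pchar_unitization).
apply: (@unitize_inj); rewrite powE !raddfD raddf_sum /= !powE.
(* Evaluation of (x t + y)^p at t = 1: the extreme coefficients are y^p and x^p, those in between
   the Jacobson terms. *)
rewrite exprD_affine_polyX big_ord_recr /= coefn_affine_polyX.
rewrite -(big_mkord xpredT (fun i => (affine_poly _ _ ^+ p)`_i)).
rewrite big_ltn // coef0_affine_polyX addrC addrA; congr (_ + _).
by apply: eq_big_nat => i lt_ip; rewrite unitize_jacobson_s.
Qed.

End Unitization.

(** * Rota-Baxter operators *)

Section RotaBaxter.
Variables (k : fieldType) (lam : k) (A : lmodType k).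
Variables (mul : A -> A -> A) (P : A -> A).
Hypothesis hAP : is_rota_baxter_algebra lam mul P.

Let hA := rb_assoc hAP.
Let linP := rb_linear hAP.

(* [P] is a morphism from this (associative) product to [mul]. *)
Definition rb_mul x y := mul (P x) y + mul x (P y) + lam *: mul x y.

Lemma rb_mulP x y : P (rb_mul x y) = mul (P x) (P y).
Proof.
by rewrite (rb_identity hAP) /rb_mul !(linear_propD linP) (linear_propZ linP).
Qed.

Lemma rb_power n x : P (iter n (rb_mul x) x) = power mul n.+1 (P x).
Proof. by elim: n => // n IHn; rewrite iterS rb_mulP IHn. Qed.

(* Formally the right-hand side is
   [((P x + lam x)^(n+1) - (P x)^(n+1)) / lam]. *)
Lemma unitize_rb_power n x :
  unitize hA (iter n (rb_mul x) x) =
  \sum_(i < n.+1) lam ^+ i *: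
    (affine_poly (unitize hA x) (unitize hA (P x)) ^+ n.+1)`_i.+1.
Proof.
set u := unitize hA x; set v := unitize hA (P x).
elim: n => [|n IHn]; first by rewrite big_ord1 coef_affine_poly scale1r.
rewrite iterS /rb_mul rb_power !raddfD /= linearZ /=.
rewrite !unitizeM unitize_power IHn.
under [RHS]eq_bigr do rewrite exprS coef_affine_polyM scalerDr.
(* The summand P(x) y of [rb_mul] accounts for the coefficients multiplied by [v]; x P(y) is [u]
   times the constant coefficient, and lam x y is [u] times the higher ones. *)
rewrite big_split /= -addrA; congr (_ + _).
  rewrite [RHS]big_ord_recr /= coef_affine_polyX_gt // mulr0 scaler0 addr0.
  rewrite mulr_sumr.
  by apply: eq_bigr => i _; rewrite scalerAr.
rewrite [RHS]big_ord_recl coef0_affine_polyX scale1r; congr (_ + _).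
rewrite mulr_sumr scaler_sumr; apply: eq_bigr => i _.
by rewrite -scalerAr scalerA -exprS.
Qed.

(** In [unitize_rb_power] with exponent [p], the top coefficient is x^p and the others are the
    Jacobson terms of [x] and [P x]. *)
Lemma pmap_R_commutator p x : p \in [pchar k] ->
  pmap_R p lam (commutator mul) (power mul p) P x = iter p.-1 (rb_mul x) x.
Proof.
case: p => [|p] pchark; first by have := pcharf_prime pchark.
rewrite pmap_R_jacobson //; last exact: commutator_lie.
apply: (@unitize_inj _ _ _ hA); rewrite unitize_rb_power addrC raddfD raddf_sum.
rewrite /= linearZ /= unitize_power big_ord_recr /= coefn_affine_polyX.
congr (_ + _); rewrite big_add1 big_mkord; apply: eq_bigr => i _.
by rewrite linearZ /= unitize_jacobson_s //= ltnS.
Qed.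

End RotaBaxter.

Theorem theorem4p13 (k : fieldType) (p : nat) (pcharkp : p \in [pchar k])
  (lam : k) (A : lmodType k) (mul : A -> A -> A) (P : A -> A)
  (hAP : is_rota_baxter_algebra lam mul P) :
  is_restricted_rota_baxter_lie_algebra p lam (commutator mul) (power mul p) P.
Proof.
have linP := rb_linear hAP.
split=> [||x y|x]; first exact: (commutator_restricted (rb_assoc hAP)).
- exact: linP.
- rewrite /commutator !(rb_identity hAP) !(linear_propB linP) scalerBr !opprD.
  rewrite (addrC (- P (mul (P y) x))) (addrACA (P (mul (P x) y) + _)).
  by rewrite (addrACA (P (mul (P x) y))).
rewrite (pmap_R_commutator hAP) // (rb_power hAP) prednK //.
by rewrite (prime_gt0 (pcharf_prime pcharkp)).
Qed.
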